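(* Every quadrangulation $Q$, with its vertices properly colored black and white, admits a strong labeling.
   Context: A quadrangulation is a simple plane graph with at least four vertices all of whose faces (including the outer face) are bounded by $4$-cycles (equivalently, a maximal bipartite plane graph). An angle is an incidence of a vertex with a face. A strong labeling of $Q$ is a map from the angles of $Q$ to $\{0,1\}$ such that: (G0) the two black vertices on the outer face are named $s_0$ and $s_1$, and all angles at $s_i$ are labeled $i$; (G1) for each vertex $v\notin\{s_0,s_1\}$ the labels around $v$ form one non-empty cyclic interval of $1$s and one non-empty cyclic interval of $0$s; (G2) for each edge, the two labels on the two sides of the edge coincide at one endpoint and differ at the other; (G3) the labels in each bounded face, read cyclically, are $0,0,1,1$, and reading the labels of the outer face in clockwise order starting at $s_0$ they are $0,0,1,1$. *)

(* Defs.v *)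
(* Plane graphs are encoded as combinatorial maps
   (rotation systems) on a finite set T of darts (half-edges). *)
From mathcomp Require Import all_boot.
Set Implicit Arguments. Unset Strict Implicit. Unset Printing Implicit Defensive.

Section PlaneMap.
Variables (T : finType) (r a : T -> T).
(* r : rotation of darts around their tail vertex, in COUNTERCLOCKWISE order
   a : edge involution (the opposite half-edge).
   Vertices = r-orbits, edges = a-orbits.
   Angles = darts: dart x stands for the angle at the tail of x between x and
   r x (counterclockwise).
   phi x := a (r x) is the previous angle along the boundary of the face
   containing angle x, for the traversal that keeps the face on the left;
   faces = phi-orbits.  For the outer face this traversal is clockwise, so
   phi goes counterclockwise around the outer face. *)

Definition phi (x : T) : T := a (r x).

Definition same_vertex (x y : T) : bool := fconnect r x y.
Definition same_face (x y : T) : bool := fconnect phi x y.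

Definition num_vertices : nat := fcard r T.
Definition num_edges : nat := fcard a T.
Definition num_faces : nat := fcard phi T.

Definition map_rel : rel T := fun x y => (y == r x) || (y == a x).

(* A connected plane map: r a permutation, a a fixed-point-free involution,
   the map is connected and has genus 0 (Euler's formula). *)
Definition plane_map : Prop :=
  [/\ injective r,
      (forall x, a (a x) = x),
      (forall x, a x != x),
      (forall x y, connect map_rel x y) &
      num_vertices + num_faces = num_edges + 2].

Definition simple_map : Prop :=
  (forall x, ~~ same_vertex x (a x)) /\
  (forall x y, same_vertex x y -> same_vertex (a x) (a y) -> x = y).

Definition quadrangulation : Prop :=
  [/\ plane_map, simple_map, 4 <= num_vertices &
      forall x, order phi x = 4 /\
        uniq [:: x; phi x; phi (phi x); phi (phi (phi x))] /\
        (forall i j, i < 4 -> j < 4 -> same_vertex (iter i phi x) (iter j phi x) -> i = j)].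

(* proper black(true)/white(false) colouring of the vertices *)
Definition proper_colouring (col : T -> bool) : Prop :=
  (forall x, col (r x) = col x) /\ (forall x, col (a x) != col x).

(* Strong labeling, with outer face = face of angle o, s0 = vertex of o
   (black), s1 = vertex of phi^2 o (the other black outer vertex). *)
Definition strong_labeling (o : T) (lam : T -> bool) : Prop :=
  let s1 := phi (phi o) in
  [/\
      (forall x, same_vertex o x -> lam x = false) /\
      (forall x, same_vertex s1 x -> lam x = true),
      (forall x, ~~ same_vertex o x -> ~~ same_vertex s1 x ->
         exists2 y, same_vertex x y &
           exists k, [/\ 0 < k, k < order r y &
             forall i, i < order r y -> lam (iter i r y) = (i < k)]),
      (* G2: at one endpoint of each edge the two labels on the two sides of
         the edge coincide, at the other endpoint they differ.  At the tail of
         dart x the two sides of the edge are the angles finv r x and x. *)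
      (forall x, (lam (finv r x) != lam x) != (lam (finv r (a x)) != lam (a x))) &
      (forall x, ~~ same_face o x ->
         exists2 y, same_face x y &
           [/\ lam y = false, lam (phi y) = false,
               lam (phi (phi y)) = true & lam (phi (phi (phi y))) = true]) /\
      (* outer face read clockwise from s0: o, phi^3 o, phi^2 o, phi o *)
      [/\ lam o = false, lam (phi (phi (phi o))) = false,
          lam (phi (phi o)) = true & lam (phi o) = true]].

End PlaneMap.

(* Main.v *)
Require Import Defs.
From mathcomp Require Import all_boot zify.

(* Join the two black corners of every face, the outer one included, to get a
   graph on the black vertices. Since [Q] is simple this graph has no cut vertex,
   so adding ears one at a time yields an st-numbering [h] with source [s0] and
   sink [s1]. Label a black angle 1 when its vertex is the higher of the two black
   corners of its face, and give the white corners the labels that (G2) and (G3)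
   then force. Around every vertex other than [s0] and [s1] both labels occur, so
   the label changes at least twice there. Each edge accounts for exactly one
   change, and there are only 2|V| - 4 edges, so every such vertex sees exactly
   two changes, which is (G1). *)

Set Implicit Arguments. Unset Strict Implicit. Unset Printing Implicit Defensive.

(** * st-numberings built by adding ears *)

Section StNumbering.
Variables (V : finType) (e : rel V) (s t : V).

(** An st-numbering of the subgraph induced on [A]. Only the order of the values matters; gaps are
    allowed. *)
Definition st_numbered (A : {set V}) (h : V -> nat) : Prop :=
  [/\ s \in A, t \in A, {in A &, injective h},
      {in A, forall x, h s <= h x <= h t} &
      {in A, forall x, x != s -> x != t ->
        (exists2 y, y \in A & e x y && (h y < h x)) /\
        (exists2 y, y \in A & e x y && (h x < h y))}].

Hypothesis e_sym : symmetric e.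

(** The interior [p] of the ear is numbered consecutively just above [h u], and the old values above
    [h u] move up by [size p]. Old comparisons survive, and [w] stays above the whole interior. *)
Lemma st_numbered_add_ear A h u w p :
  st_numbered A h -> u \in A -> w \in A -> h u < h w -> uniq p ->
  {in p, forall x, x \notin A} -> path e u (rcons p w) ->
  exists h', st_numbered (A :|: [set x in p]) h'.
Proof.
move=> [sA tA injh bnd nbr] uA wA ltuw Up pA ep.
pose h' x := if x \in p then h u + (index x p).+1
             else if h x <= h u then h x else h x + size p.
have notp x : x \in A -> x \in p = false.
  by move=> xA; apply/negP => /pA; rewrite xA.
have h'A x : x \in A -> h' x = if h x <= h u then h x else h x + size p.
  by move=> xA; rewrite /h' notp.
have h'p x : x \in p -> h' x = h u + (index x p).+1 by rewrite /h' => ->.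
have idx x : x \in p -> index x p < size p by rewrite index_mem.
have mono x y : x \in A -> y \in A -> h x < h y -> h' x < h' y.
  by move=> xA yA; rewrite !h'A //; do 2!case: ifP; lia.
have [us ut] := (bnd _ uA, bnd _ wA).
exists h'; split.
- by rewrite inE sA.
- by rewrite inE tA.
- move=> x y; rewrite !inE => /orP[xA|xp] /orP[yA|yp].
  + rewrite !h'A // => hxy; apply: injh => //; move: hxy; do 2!case: ifP; lia.
  + rewrite (h'A x) // (h'p y) //; have := idx _ yp; case: ifP; lia.
  + rewrite (h'A y) // (h'p x) //; have := idx _ xp; case: ifP; lia.
  + rewrite !h'p // => hxy; have ixy : index x p = index y p by lia.
    by rewrite -(nth_index u xp) ixy nth_index.
- move=> x; rewrite !inE (h'A s) // (h'A t) // => /orP[xA|xp].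
  + rewrite h'A //; have := bnd _ xA; do 3!case: ifP; lia.
  + rewrite h'p //; have := idx _ xp; do 2!case: ifP; lia.
- move=> x; rewrite !inE => /orP[xA|xp] xs xt.
    have [[y yA /andP[exy hy]] [z zA /andP[exz hz]]] := nbr _ xA xs xt.
    split; [exists y|exists z]; rewrite ?inE ?yA ?zA ?exy ?exz //=;
      exact: mono.
have /(nthP u)[i ltx xE] := xp.
have /(pathP u) epi := ep; rewrite size_rcons in epi.
have h'nth j : j < size p -> h' (nth u p j) = h u + j.+1.
  by move=> jp; rewrite h'p ?mem_nth // index_uniq.
have h'x : h' x = h u + i.+1 by rewrite -xE h'nth.
split.
  (* The lower neighbour of the [i]-th interior vertex is its predecessor on the ear, which is [u]
     itself when [i = 0]. *)
  exists (nth u (u :: p) i).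
    by case: {+}i ltx => [|j] ltj /=; rewrite !inE ?uA // mem_nth ?orbT // ltnW.
  have := epi i (leqW ltx); rewrite nth_rcons ltx xE -rcons_cons nth_rcons /=.
  rewrite ltnS ltnW // e_sym => -> /=; rewrite h'x.
  case: {+}i ltx => [|j] ltj /=; last by rewrite h'nth; lia.
  by rewrite h'A //; case: ifP; lia.
exists (nth u (rcons p w) i.+1).
  rewrite nth_rcons; case: ltnP => [lti|lei]; first by rewrite !inE mem_nth ?orbT.
  have -> : i.+1 == size p by rewrite eqn_leq ltx lei.
  by rewrite inE wA.
have := epi i.+1; rewrite ltnS => /(_ ltx) /=; rewrite [in X in e X _]nth_rcons ltx xE => -> /=.
rewrite h'x nth_rcons; case: (ltnP i.+1 (size p)) => [lti|lei]; first by rewrite h'nth //; lia.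
have -> : i.+1 == size p by rewrite eqn_leq ltx lei.
by rewrite h'A //; case: ifP; lia.
Qed.

(** The graph with [u] deleted; testing both endpoints keeps the relation symmetric. *)
Definition avoiding u : rel V := [rel x y | [&& e x y, x != u & y != u]].

(** A simple path from [v] to [w] off [u] is cut at its first vertex in [A]. Since the path misses
    [u], the two ends of the ear differ. *)
Lemma find_ear (A : {set V}) u v w :
  u \in A -> w \in A -> v \notin A -> e u v -> connect (avoiding u) v w ->
  exists p w', [/\ w' \in A, w' != u, uniq (v :: p), {in v :: p, forall x, x \notin A}
    & path e u (rcons (v :: p) w')].
Proof.
move=> uA wA vA euv /connectP[q pq wE].
rewrite {}wE in wA; case/shortenP: pq wA => q' pq' Uq' _ wA.
have hasA : has [in A] q'.
  apply/hasP; exists (last v q') => //.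
  by case: q' {pq' Uq'} wA => [|z q'] /=; [rewrite (negPf vA)|rewrite mem_last].
case: (split_find hasA) pq' Uq' => w' p1 p2 w'A hasp1.
rewrite cat_path => /andP[pp1 _].
rewrite -cat_cons cat_uniq => /andP[Up _].
exists p1, w'; split=> //.
- have : path [rel x y | y != u] v (rcons p1 w').
    by apply: sub_path pp1 => x y /= /and3P[].
  by rewrite rcons_path => /andP[].
- by move: Up; rewrite -rcons_cons rcons_uniq => /andP[].
- move=> x; rewrite inE => /orP[/eqP->//|xp1].
  by apply/negP => xA; case/hasP: hasp1; exists x.
- by rewrite rcons_cons /= euv; apply: sub_path pp1 => x y /= /and3P[].
Qed.

(** Induction on the number of vertices of [B] not yet numbered, each round adding one ear. *)
Lemma st_numbering (B : {set V}) :
  (forall x y, e x y -> x \in B) -> s \in B -> t \in B -> s != t ->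
  (forall u v w, v \in B -> w \in B -> v != u -> w != u ->
     connect (avoiding u) v w) ->
  exists h, st_numbered B h.
Proof.
move=> eB sB tB st conn.
have eB' x y : e x y -> y \in B by rewrite e_sym; apply: eB.
suff IH n : forall A h, #|B :\: A| <= n -> A \subset B -> st_numbered A h ->
    exists h', st_numbered B h'.
  (* Start from [s] and [t] alone, numbered 0 and 1; the neighbour condition is then vacuous. *)
  apply: (IH #|B :\: [set s; t]| [set s; t] (fun x => x == t : nat)) => //.
    by apply/subsetP => x; rewrite !inE => /orP[]/eqP->.
  split; rewrite ?inE ?eqxx ?orbT //.
  - move=> x y; rewrite !inE => /orP[]/eqP-> /orP[]/eqP-> //;
      by rewrite /= eqxx (negPf st).
  - by move=> x _; rewrite /= (negPf st); case: (x == t).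
  - by move=> x; rewrite !inE => /orP[]/eqP->; rewrite eqxx.
elim: n => [|n IHn] A h cardA AB good.
  have BA : B \subset A by rewrite -setD_eq0 -cards_eq0 -leqn0.
  by exists h; rewrite (_ : B = A) //; apply/eqP; rewrite eqEsubset BA.
have [BA|/subsetPn[v0 v0B v0A]] := boolP (B \subset A).
  by exists h; rewrite (_ : B = A) //; apply/eqP; rewrite eqEsubset BA.
have [sA tA injh _ _] := good.
(* A path from [s] to the missing vertex [v0], obtained by deleting [t], has an edge that leaves
   [A]. *)
have [u [v [uA vA euv]]] : exists u v, [/\ u \in A, v \notin A & e u v].
  have v0t : v0 != t by apply: contraNneq v0A => ->.
  have /connectP[q pq v0E] := conn t s v0 sB v0B st v0t.
  rewrite v0E {v0E v0B v0t} in v0A.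
  elim: q {+}s sA pq v0A => [|z q IHq] x xA /=; first by rewrite xA.
  case/andP=> /and3P[exz _ _] pq lastA.
  by have [zA|zA] := boolP (z \in A); [apply: IHq pq lastA|exists x, z].
have [w wA wu] : exists2 w, w \in A & w != u.
  by have [<-|su] := eqVneq s u; [exists t; rewrite // eq_sym|exists s].
have vu : v != u by apply: contraNneq vA => ->.
have [] := @find_ear A u v w uA wA vA euv.
  by apply: conn => //; [apply: eB' euv|apply: (subsetP AB)].
move=> p [w' [w'A w'u Up pA ep]].
suff [h' good'] : exists h', st_numbered (A :|: [set x in v :: p]) h'.
  apply: IHn good'.
    rewrite -ltnS; apply: leq_trans cardA; apply: proper_card.
    apply/properP; split; first by apply: setDS; apply: subsetUl.
    by exists v; rewrite !inE ?eqxx ?orbT // vA (eB' _ _ euv).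
  apply/subsetP => x; rewrite in_setU => /orP[/(subsetP AB)//|].
  rewrite inE => /(nthP u)[i ip <-].
  have /(pathP u)/(_ i) := ep; rewrite size_rcons ltnS => /(_ (ltnW ip)).
  by rewrite nth_rcons ip => /eB'.
(* The ear must run from its lower end to its higher end, so it is reversed if necessary. *)
have [ltuw|ltwu|/injh] := ltngtP (h u) (h w').
- exact: st_numbered_add_ear good uA w'A ltuw Up pA ep.
- have [|||h' good'] := @st_numbered_add_ear A h w' u (rev (v :: p)) good w'A uA ltwu.
  + by rewrite rev_uniq.
  + by move=> x; rewrite mem_rev; apply: pA.
  + have := rev_path e u (rcons (v :: p) w').
    rewrite last_rcons belast_rcons rev_cons => ->.
    by rewrite -(eq_path (e := e)) // => x y; rewrite e_sym.
  exists h'; move: good'; congr (st_numbered (_ :|: _) _).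
  by apply/setP => x; rewrite !inE mem_rev inE.
- by move=> /(_ uA w'A) uw'; rewrite uw' eqxx in w'u.
Qed.

End StNumbering.

(** * Counting label changes around a vertex *)

Section Changes.
Variables (T : finType) (r : T -> T) (lam : T -> bool).
Hypothesis rI : injective r.

Definition change (x : T) : bool := lam (finv r x) != lam x.

(** Rotating from a 0 to a 1 passes a place where 0 turns into 1. As the orbit is cyclic, the walk
    may go from [x] to [y] or from [y] to [x]. *)
Lemma exists_ascent x y :
  fconnect r x y -> lam x != lam y ->
  exists2 z, fconnect r x z & lam z && ~~ lam (finv r z).
Proof.
suff ascent u v : fconnect r u v -> ~~ lam u -> lam v ->
    exists2 z, fconnect r u z & lam z && ~~ lam (finv r z).
  move=> xy; case: (boolP (lam x)) => lx; last first.
    by move=> ly; apply: ascent xy lx _; case: (lam y) ly.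
  move=> ly; have yx : fconnect r y x by rewrite fconnect_sym.
  have [z yz lz] := ascent _ _ yx ly lx.
  by exists z; first apply: connect_trans yz.
move=> /iter_findex <- lu; elim: (findex r u v) => [|i IHi] /=.
  by rewrite (negPf lu).
case: (boolP (lam (iter i r u))) => [/IHi//|nli li].
by exists (iter i.+1 r u); rewrite ?fconnect_iter //= finv_f // li.
Qed.

Lemma iter_lt_order_inj y i j :
  i < order r y -> j < order r y -> (iter i r y == iter j r y) = (i == j).
Proof.
by move=> ri rj; apply/eqP/eqP => [eij|->//]; rewrite -(findex_iter ri) eij findex_iter.
Qed.

Lemma change_count_ge x (s : seq T) :
  uniq s -> {in s, forall y, fconnect r x y && change y} ->
  size s <= \sum_(y | fconnect r x y) change y.
Proof.
move=> Us sx; rewrite -big_mkcondr sum1_card cardE.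
by apply: uniq_leq_size Us _ => y /sx; rewrite mem_enum.
Qed.

Lemma first_descent y :
  lam y -> ~~ lam (finv r y) ->
  exists k, [/\ 0 < k, k < order r y, forall i, i < k -> lam (iter i r y)
    & ~~ lam (iter k r y)].
Proof.
(* [finv r y] is by definition the iterate number [(order r y).-1], which also bounds the least
   [k]. *)
move=> ly nly; have exk : exists k, ~~ lam (iter k r y) by exists (order r y).-1.
case: (ex_minnP exk) => k nlk mink; exists k; split => //.
- by case: k nlk {mink} => //=; rewrite ly.
- by have := mink _ nly; rewrite -ltnS prednK ?order_gt0.
- by move=> i; apply: contraTT => /mink; rewrite -leqNgt.
Qed.

Lemma change_iterS y i : change (iter i.+1 r y) = (lam (iter i r y) != lam (iter i.+1 r y)).
Proof. by rewrite /change /= finv_f. Qed.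

Lemma two_changes x y :
  fconnect r x y -> lam x != lam y -> 1 < \sum_(z | fconnect r x z) change z.
Proof.
move=> xy lxy.
have [z xz /andP[lz nlz]] := exists_ascent xy lxy.
have [k []] := first_descent lz nlz; case: k => // k _ kr lk nlk.
apply: (@change_count_ge x [:: z; iter k.+1 r z]).
  by rewrite /= inE andbT (@iter_lt_order_inj z 0 k.+1) // order_gt0.
move=> w; rewrite !inE => /orP[]/eqP->; first by rewrite xz /change lz (negPf nlz).
rewrite (connect_trans xz) ?fconnect_iter // change_iterS (negPf nlk).
by rewrite lk.
Qed.

Lemma interval_of_two_changes x y :
  fconnect r x y -> lam x != lam y ->
  \sum_(z | fconnect r x z) change z <= 2 ->
  exists2 z, fconnect r x z & exists k, [/\ 0 < k, k < order r z &
    forall i, i < order r z -> lam (iter i r z) = (i < k)].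
Proof.
move=> xy lxy le2.
have [z xz /andP[lz nlz]] := exists_ascent xy lxy.
exists z => //; have [k [k0 kr lk nlk]] := first_descent lz nlz.
exists k; split=> // i; elim: i => [|i IHi] ir; first by rewrite lz k0.
have [ltik|leki] := ltnP i.+1 k; first exact: lk.
have [ikE|nik] := eqVneq i.+1 k; first by rewrite ikE (negPf nlk).
have ki : k <= i by rewrite -ltnS ltn_neqAle eq_sym nik.
have := IHi (ltnW ir); rewrite [i < k]ltnNge ki => nli.
apply/negP => li; move: le2; rewrite leqNgt => /negP[].
(* A 1 reappearing after the first descent [k] would be a third change, besides the ascent at [z]
   and the descent at [k]. *)
apply: (@change_count_ge x [:: z; iter k r z; iter i.+1 r z]).
  rewrite /= !inE negb_or (@iter_lt_order_inj z 0 k) ?order_gt0 //.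
  rewrite (@iter_lt_order_inj z 0 i.+1) ?order_gt0 //.
  by rewrite (@iter_lt_order_inj z k i.+1) // [k == _]eq_sym nik andbT /= eq_sym -lt0n k0.
move=> w; rewrite !inE => /or3P[]/eqP->.
- by rewrite xz /change lz (negPf nlz).
- case: k k0 nlk lk {IHi kr leki nik ki} => // k _ nlk lk.
  by rewrite (connect_trans xz) ?fconnect_iter // change_iterS (negPf nlk) lk.
- by rewrite (connect_trans xz) ?fconnect_iter // change_iterS li nli.
Qed.

End Changes.

(** The [#|P| - 3] terms other than [p], [q] and [x] use up at least [2 * #|P| - 6] of a total of at
    most [2 * #|P| - 4]. *)
Lemma le2_of_tight_sum (I : finType) (P : pred I) (c : I -> nat) p q x :
  P p -> P q -> P x -> q != p -> x != p -> x != q ->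
  (forall i, P i -> i != p -> i != q -> 1 < c i) ->
  \sum_(i | P i) c i + 4 <= 2 * #|P| -> c x <= 2.
Proof.
move=> Pp Pq Px qp xp xq c2; rewrite -sum1_card.
have bigD F : \sum_(i | P i) F i = F p + (F q + (F x +
    \sum_(i | [&& P i, i != p, i != q & i != x]) F i)) :> nat.
  rewrite (bigD1 p) // (bigD1 q) /= ?Pq // (bigD1 x) /= ?Px ?xp //.
  by do 3!congr (_ + _); apply: eq_bigl => i; rewrite -!andbA.
rewrite !bigD; set s1 := bigop _ _ _; set s2 := bigop _ _ _.
suff : 2 * s2 <= s1 by lia.
by rewrite big_distrr; apply: leq_sum => i /and4P[Pi ip iq _]; apply: c2.
Qed.

(** * The graph of opposite black corners *)

Section Quadrangulation.
Variables (T : finType) (r a : T -> T) (col : T -> bool).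
Hypotheses (Q : quadrangulation r a) (Hcol : proper_colouring r a col).

Let phi := phi r a.
Let rI : injective r. Proof. by case: Q => [[]]. Qed.
Let aK : involutive a. Proof. by case: Q => [[]]. Qed.
Let rsym := fconnect_sym rI.
(** A vertex is represented by the canonical dart of its [r]-orbit, so graphs on vertices become
    relations on [T]. *)
Let vtx := froot r.

Lemma vtxE x y : (vtx x == vtx y) = same_vertex r x y.
Proof. exact: root_connect. Qed.

Lemma vtx_r x : vtx (r x) = vtx x.
Proof. by apply/eqP; rewrite vtxE /same_vertex rsym fconnect1. Qed.

Lemma vtx_iter i x : vtx (iter i r x) = vtx x.
Proof. by elim: i => //= i IHi; rewrite vtx_r. Qed.

Lemma vtx_finv x : vtx (finv r x) = vtx x.
Proof. by rewrite -{2}(f_finv rI x) vtx_r. Qed.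

Lemma vtx_id x : vtx (vtx x) = vtx x.
Proof. exact: root_root. Qed.

Lemma vtxP x y : vtx x = vtx y -> exists2 i, i < order r x & y = iter i r x.
Proof.
move/eqP; rewrite vtxE => xy; exists (findex r x y); first exact: findex_max.
by rewrite iter_findex.
Qed.

Lemma col_vtx x : col (vtx x) = col x.
Proof.
have [i _ xE] := vtxP (vtx_id x); rewrite [in RHS]xE.
by elim: i {xE} => //= i ->; case: Hcol => ->.
Qed.

Lemma col_a x : col (a x) = ~~ col x.
Proof. by case: Hcol => _ /(_ x); case: (col x) (col (a x)) => [] []. Qed.

Lemma col_phi x : col (phi x) = ~~ col x.
Proof. by rewrite col_a; case: Hcol => ->. Qed.

Lemma phiI : injective phi.
Proof. by move=> x y phixy; apply/rI/(can_inj aK). Qed.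

Lemma phi4 x : phi (phi (phi (phi x))) = x.
Proof. by case: Q => _ _ _ /(_ x)[o4 _]; have := iter_order phiI x; rewrite o4. Qed.

(** Faces have length 4, so the third iterate of [phi] is its inverse. *)
Lemma phi3 x : phi (phi (phi x)) = finv r (a x).
Proof. by apply: phiI; rewrite phi4 /phi /Defs.phi f_finv ?aK. Qed.

Lemma vtx_phi3 x : vtx (phi (phi (phi x))) = vtx (a x).
Proof. by rewrite phi3 vtx_finv. Qed.

Lemma vtx_phi2 x : vtx (phi (phi x)) != vtx x.
Proof.
case: Q => _ _ _ /(_ x)[_ [_ neq]]; apply/negP; rewrite vtxE => eq20.
by have := neq 2 0 isT isT eq20.
Qed.

Definition opposite : rel T := fun x y =>
  [exists z, [&& col z, vtx z == x & vtx (phi (phi z)) == y]].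

Lemma opposite_sym : symmetric opposite.
Proof.
suff imp x y : opposite x y -> opposite y x by move=> x y; apply/idP/idP; apply: imp.
case/existsP=> z /and3P[cz zx zy]; apply/existsP; exists (phi (phi z)).
by rewrite phi4 !col_phi negbK cz zx zy.
Qed.

Lemma opposite_phi2 x : col x -> opposite (vtx x) (vtx (phi (phi x))).
Proof. by move=> cx; apply/existsP; exists x; rewrite cx !eqxx. Qed.

Definition black_vertices : {set T} := [set x | (vtx x == x) && col x].

Lemma vtx_black x : col x -> vtx x \in black_vertices.
Proof. by move=> cx; rewrite inE vtx_id eqxx col_vtx. Qed.

Lemma black_vtx x : x \in black_vertices -> vtx x = x.
Proof. by rewrite inE => /andP[/eqP]. Qed.

(** * Deleting a black vertex [u] keeps the black graph connected *)

Section NoCutVertex.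
Variables u v : T.

Let S x := connect (avoiding opposite u) v (vtx x).

Let avoiding_sym : connect_sym (avoiding opposite u).
Proof.
by apply: sym_connect_sym => x y; rewrite /avoiding /= opposite_sym [(x != u) && _]andbC.
Qed.

Let S_phi2 x : col x -> vtx x != u -> vtx (phi (phi x)) != u -> S x = S (phi (phi x)).
Proof.
move=> cx xu yu; apply: (same_connect_r avoiding_sym).
by apply: connect1; rewrite /avoiding /= opposite_phi2 // xu.
Qed.

Let S_vtx x y : vtx x = vtx y -> S x = S y.
Proof. by rewrite /S => ->. Qed.

(** Consecutive black neighbours of a white vertex are the two black corners of the face between
    them. *)
Let S_white y : ~~ col y -> vtx (a y) != u -> vtx (a (r y)) != u ->
  S (a y) = S (a (r y)).
Proof.
move=> cy yu ryu; rewrite -(S_vtx (vtx_phi3 y)) -[a (r y)]/(phi y).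
by symmetry; apply: S_phi2; rewrite ?col_phi // vtx_phi3.
Qed.

Let white_reached x :=
  [exists y, [&& vtx y == vtx x, vtx (a y) != u & S (a y)]].

(* Simplicity makes [u] occur at most once around a white vertex, so the other
   black neighbours of that vertex are still linked consecutively. *)
Let white_reached_all x :
  ~~ col x -> white_reached x -> vtx (a x) != u -> S (a x).
Proof.
move=> cx /existsP[y /and3P[/eqP yx ayu Say]] axu.
have cvtx z : vtx z = vtx x -> ~~ col z by move=> zx; rewrite -col_vtx zx col_vtx.
(* If the dart [z] leads to [u], rotation is counted from [z], so the remaining darts form an
   unbroken run; if no dart does, the whole rotation is unbroken. *)
have [/existsP[z /andP[/eqP zx /eqP azu]]|noz] :=
  boolP [exists z, (vtx z == vtx x) && (vtx (a z) == u)]; last first.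
  have nou z : vtx z = vtx x -> vtx (a z) != u.
    move=> zx; apply: contra noz => azu; apply/existsP.
    by exists z; rewrite zx eqxx.
  have [i _ ->] := vtxP yx; elim: i => //= i IHi.
  by rewrite -S_white ?cvtx -?iterS ?nou ?vtx_iter.
have nou i : 0 < i -> i < order r z -> vtx (a (iter i r z)) != u.
  move=> i0 ir; apply/negP; rewrite -azu vtxE => sv.
  have [_ [_ simp] _ _] := Q.
  have /simp/(_ sv)/eqP : same_vertex r (iter i r z) z by rewrite -vtxE vtx_iter.
  by rewrite (@iter_lt_order_inj _ r z i 0) ?order_gt0 // gtn_eqF.
have Sz i : i.+1 < order r z -> S (a (iter i.+1 r z)) = S (a (r z)).
  elim: i => // i IHi ir; rewrite -IHi; last exact: ltnW.
  rewrite [RHS]S_white ?cvtx ?vtx_iter //; last exact: (nou i.+2).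
  exact: nou (ltnW ir).
have [i ir xE] := vtxP zx; have [j jr yE] := vtxP (etrans zx (esym yx)).
case: i ir xE => [|i] ir xE; first by rewrite xE azu eqxx in axu.
case: j jr yE => [|j] jr yE; first by rewrite yE azu eqxx in ayu.
by rewrite xE Sz // -(Sz j) // -yE.
Qed.

Let reached x :=
  if col x then (if vtx x == u then white_reached (a x) else S x)
  else white_reached x.

Let white_reached_vtx x y : vtx x = vtx y -> white_reached x = white_reached y.
Proof. by rewrite /white_reached => ->. Qed.

Let reached_a x : reached x -> reached (a x).
Proof.
rewrite /reached col_a aK; case: (boolP (col x)) => cx /=.
  case: ifPn => // xu Sx; apply/existsP; exists (a x).
  by rewrite aK eqxx xu Sx.
by case: ifPn => // axu wx; apply: white_reached_all.
Qed.

(** The only real case is rotation at [u]: the white neighbours [a x] and [a (r x)] lie on a common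
    face, and its other black corner, distinct from [u], is adjacent to both. *)
Let reached_r x : reached x -> reached (r x).
Proof.
rewrite /reached (_ : col (r x) = col x); last by case: Hcol.
rewrite vtx_r (white_reached_vtx (vtx_r x)) (S_vtx (vtx_r x)).
case: (boolP (col x)) => // cx; case: ifP => // /eqP xu wax.
have oppu : vtx (phi (phi x)) != u by rewrite -xu vtx_phi2.
have Sopp : S (phi (phi x)).
  rewrite -(S_vtx (vtx_r _)) -[r _]aK -[a (r _)]/(phi (phi (phi x))).
  apply: white_reached_all; first by rewrite !col_phi cx.
    by rewrite (white_reached_vtx (vtx_phi3 x)).
  by rewrite /phi /Defs.phi aK vtx_r.
by apply/existsP; exists (r (phi x)); rewrite vtx_r eqxx oppu Sopp.
Qed.

Lemma no_cut_vertex w :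
  v \in black_vertices -> w \in black_vertices -> v != u -> w != u ->
  connect (avoiding opposite u) v w.
Proof.
move=> vB wB vu wu; have [[_ _ _ conn _] _ _ _] := Q.
have : reached w.
  have : reached v.
    rewrite /reached /S (black_vtx vB) (negPf vu) connect0.
    by move: vB; rewrite inE => /andP[_ ->].
  case/connectP: (conn v w) => p; elim: p {vB vu} v => [|y p IHp] x /=.
    by move=> _ ->.
  case/andP=> /orP[]/eqP-> pp wE ?; apply: IHp pp wE _.
    exact: reached_r.
  exact: reached_a.
rewrite /reached /S (black_vtx wB) (negPf wu).
by move: wB; rewrite inE => /andP[_ ->].
Qed.

End NoCutVertex.

(** * Euler's formula and the total number of changes *)

Lemma num_edges_darts : num_edges a * 2 = #|T|.
Proof.
have [[_ _ aN _ _] _ _ _] := Q.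
rewrite /num_edges fcard_order_set //; first exact: (can_inj aK).
apply/subsetP => x _; rewrite inE; apply/eqP.
by apply: (@order_cycle _ a [:: x; a x]); rewrite /= ?aK ?inE ?eqxx // eq_sym aN.
Qed.

Lemma num_faces_darts : num_faces r a * 4 = #|T|.
Proof.
rewrite /num_faces fcard_order_set //; first exact: phiI.
by apply/subsetP => x _; rewrite inE; case: Q => _ _ _ /(_ x)[-> _].
Qed.

(** Counting darts by edges and by faces gives [2E = 4F], so Euler's formula becomes
    [E = 2V - 4]. *)
Lemma num_edges_vertices : num_edges a + 4 = 2 * num_vertices r.
Proof.
have [[_ _ _ _ euler] _ _ _] := Q.
move: euler num_edges_darts num_faces_darts; lia.
Qed.

(** Adding the sum to its reindexing by [a] counts 1 for every dart, hence 2 for every edge. *)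
Lemma sum_change lam :
  (forall x, change r lam x != change r lam (a x)) ->
  \sum_x change r lam x = num_edges a.
Proof.
move=> lamE; apply/eqP; rewrite -(eqn_pmul2r (isT : 0 < 2)) num_edges_darts.
rewrite muln2 -addnn {2}(reindex_inj (can_inj aK)) -big_split -sum1_card.
apply/eqP/eq_bigr => x _; have := lamE x.
by case: (change r lam x); case: (change r lam (a x)).
Qed.

Lemma sum_vertices (F : T -> nat) :
  \sum_x F x = \sum_(x | froots r x) \sum_(y | fconnect r x y) F y.
Proof.
rewrite (partition_big vtx (froots r)) => [|x _]; last exact: roots_root.
apply: eq_bigr => x /eqP rx; apply: eq_bigl => y.
by rewrite -[x in LHS]rx [LHS]eq_sym vtxE.
Qed.

(** * The labeling and its properties *)

Variable o : T.
Let s1 := phi (phi o).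

Lemma labels_form_interval lam x :
  (forall x, change r lam x != change r lam (a x)) ->
  (forall x, ~~ same_vertex r o x -> ~~ same_vertex r s1 x ->
     exists2 y, same_vertex r x y & lam x != lam y) ->
  ~~ same_vertex r o x -> ~~ same_vertex r s1 x ->
  exists2 y, same_vertex r x y & exists k, [/\ 0 < k, k < order r y &
    forall i, i < order r y -> lam (iter i r y) = (i < k)].
Proof.
move=> lamE nonconst xo xs1; have [y xy lxy] := nonconst _ xo xs1.
apply: (interval_of_two_changes rI xy lxy).
rewrite -vtxE eq_sym in xo; rewrite -vtxE eq_sym in xs1.
rewrite (eq_bigl (fconnect r (vtx x))); last first.
  by move=> z; rewrite -!/(same_vertex r _ _) -!vtxE vtx_id.
(* The two exempt indices are the outer black vertices, where no change is required. *)
apply: (@le2_of_tight_sum _ (froots r) (fun x => \sum_(y | fconnect r x y) change r lam y)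
  (vtx o) (vtx s1)) => //; try exact: roots_root.
- exact: vtx_phi2.
- move=> z /eqP zr; rewrite -zr -/vtx => zo zs1.
  have [||z' zz' lzz'] := nonconst z; try by rewrite -vtxE eq_sym.
  rewrite (eq_bigl (fconnect r z)); first exact: two_changes zz' lzz'.
  by move=> w; rewrite -!/(same_vertex r _ _) -!vtxE vtx_id.
- rewrite -sum_vertices sum_change // num_edges_vertices leq_eqVlt; apply/orP; left.
  by rewrite /num_vertices; apply/eqP; congr (2 * _); apply: eq_card => z; rewrite !inE andbT.
Qed.

Hypothesis col_o : col o.

Lemma strong_labeling_exists : exists lam, strong_labeling r a o lam.
Proof.
have cs1 : col s1 by rewrite !col_phi negbK.
have [] := @st_numbering _ opposite (vtx o) (vtx s1) opposite_sym black_vertices.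
- by move=> x y /existsP[z /and3P[cz /eqP<- _]]; apply: vtx_black.
- exact: vtx_black.
- exact: vtx_black.
- by rewrite eq_sym vtx_phi2.
- exact: no_cut_vertex.
move=> h [_ _ hI hbnd hnbr]; pose H x := h (vtx x).
have col_phi2 x : col x -> col (phi (phi x)) by rewrite !col_phi negbK.
have Hneq x : col x -> H (phi (phi x)) != H x.
  move=> cx; apply: contra (vtx_phi2 x) => /eqP Heq; apply/eqP.
  by apply: hI Heq; apply: vtx_black; rewrite ?col_phi2.
have Hlt x : col x -> ~~ (H (phi (phi x)) < H x) = (H x < H (phi (phi x))).
  by move=> cx; rewrite -leqNgt leq_eqVlt eq_sym (negPf (Hneq x cx)).
have Hbnd x : col x -> H o <= H x <= H s1 by move=> cx; apply/hbnd/vtx_black.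
have Hvtx x y : same_vertex r x y -> H x = H y by rewrite -vtxE /H => /eqP->.
(* A white angle [x] gets the label of the black angle [phi x]: the black corners of its face lie at
   [a x] and [a (r x)]. *)
pose lam x := if col x then H (phi (phi x)) < H x else H (a x) < H (a (r x)).
have lam_phi x : col x -> lam (phi x) = ~~ lam x.
  move=> cx; rewrite /lam col_phi cx Hlt //=.
  by congr (_ < _); rewrite /phi /Defs.phi aK /H vtx_r.
have lam_phi2 x : col x -> lam (phi (phi x)) = ~~ lam x.
  by move=> cx; rewrite /lam col_phi2 // cx phi4 Hlt.
have lam_phi3 x : col x -> lam (phi (phi (phi x))) = lam x.
  by move=> cx; rewrite lam_phi ?lam_phi2 ?negbK // col_phi2.
have lam_o x : same_vertex r o x -> lam x = false.
  move=> ox; have cx : col x.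
    by rewrite -col_vtx; move: ox; rewrite -vtxE => /eqP<-; rewrite col_vtx.
  rewrite /lam cx ltnNge -(Hvtx _ _ ox).
  by have /andP[-> _] := Hbnd _ (col_phi2 x cx).
have lam_s1 x : same_vertex r s1 x -> lam x = true.
  move=> sx; have cx : col x.
    by rewrite -col_vtx; move: sx; rewrite -vtxE => /eqP<-; rewrite col_vtx.
  rewrite /lam cx ltn_neqAle Hneq // -(Hvtx _ _ sx).
  by have /andP[_ ->] := Hbnd _ (col_phi2 x cx).
(* For a black dart [y], the angles at the white end are [phi (finv r y)], which negates the label
   of [finv r y], and [finv r (a y)], which copies that of [y]. So exactly one end sees a change. *)
have lamE x : change r lam x != change r lam (a x).
  suff black y : col y -> change r lam y != change r lam (a y).
    case: (boolP (col x)) => [/black//|cx].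
    by rewrite eq_sym -{2}(aK x); apply: black; rewrite col_a.
  move=> cy; have cfy : col (finv r y) by rewrite -col_vtx vtx_finv col_vtx.
  rewrite /change -phi3 lam_phi3 // (_ : a y = phi (finv r y)) ?lam_phi //.
    by case: (lam _) (lam _) => [] [].
  by rewrite /phi /Defs.phi f_finv.
have nonconst x : ~~ same_vertex r o x -> ~~ same_vertex r s1 x ->
    exists2 y, same_vertex r x y & lam x != lam y.
  move=> xo xs1.
  suff [[y xy ly] [z xz lz]] : (exists2 y, same_vertex r x y & lam y) /\
      (exists2 z, same_vertex r x z & ~~ lam z).
    by case lx: (lam x); [exists z => //; case: (lam z) lz|exists y; rewrite ?ly].
  case: (boolP (col x)) => cx.
    (* At a black vertex the lower neighbour yields a label 1 and the higher one a label 0. *)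
    have [||[y _ /andP[xy hy]] [z _ /andP[xz hz]]] := hnbr _ (vtx_black cx).
    - by rewrite eq_sym vtxE.
    - by rewrite eq_sym vtxE.
    case/existsP: xy => y' /and3P[cy' y'x /eqP y'y].
    case/existsP: xz => z' /and3P[cz' z'x /eqP z'z].
    split; [exists y'|exists z']; rewrite -?vtxE ?(eqP y'x) ?(eqP z'x) //.
      by rewrite /lam cy' /H y'y (eqP y'x).
    by rewrite /lam cz' -leqNgt /H z'z (eqP z'x) ltnW.
  have cvtx z : same_vertex r x z -> ~~ col z.
    by rewrite -vtxE -col_vtx => /eqP<-; rewrite col_vtx.
  have next z : same_vertex r x z -> same_vertex r x (r z).
    by rewrite -!vtxE vtx_r.
  have xx : same_vertex r x x by apply: connect0.
  split.
    (* At a white vertex the dart to the lowest black neighbour carries a 1, as the next neighbour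
       is strictly higher; the dart to the highest carries a 0. *)
    case: (arg_minnP (fun y => H (a y)) xx) => y xy miny; exists y => //.
    have cy := cvtx y xy; rewrite /lam (negPf cy) ltn_neqAle miny ?next // andbT.
    have := Hneq (phi y); rewrite col_phi => /(_ cy).
    by rewrite /H vtx_phi3.
  case: (arg_maxnP (fun y => H (a y)) xx) => y xy maxy; exists y => //.
  by rewrite /lam (negPf (cvtx y xy)) -leqNgt; apply/maxy/next.
exists lam; split.
- by split.
- by move=> x xo xs1; apply: labels_form_interval.
- exact: lamE.
split.
- move=> x _.
  suff black y : col y -> exists2 z, same_face r a y z &
      [/\ lam z = false, lam (phi z) = false,
          lam (phi (phi z)) = true & lam (phi (phi (phi z))) = true].
    case: (boolP (col x)) => [/black//|cx].
    have [|z xz lz] := black (phi x); first by rewrite col_phi.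
    by exists z => //; apply: connect_trans xz; apply: fconnect1.
  (* From a black angle labelled [l], [phi] reads [l], [~~ l], [~~ l], [l]; the witness is where the
     two 0s begin. *)
  move=> cy; case ly: (lam y).
    exists (phi y); first exact: fconnect1.
    by rewrite phi4 lam_phi3 // lam_phi2 // lam_phi // ly.
  exists (phi (phi (phi y))); first exact: (fconnect_iter phi 3).
  by rewrite phi4 lam_phi3 // lam_phi2 // lam_phi // ly.
- rewrite -/phi lam_phi3 // lam_phi2 // lam_phi //.
  by rewrite (lam_o o) //; apply: connect0.
Qed.

End Quadrangulation.

Theorem theorem12 (T : finType) (r a : T -> T) (col : T -> bool) (o : T) :
  quadrangulation r a -> proper_colouring r a col -> col o = true ->
  exists lam : T -> bool, strong_labeling r a o lam.
Proof. by move=> Q Hcol col_o; apply: (strong_labeling_exists Q Hcol). Qed.
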